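(* Let $\mathbb{F}$ be a finite field with $q$ elements and let $A\in \mathrm{GL}(2,\mathbb{F}[x])$ be a semisimple matrix, not equal to the identity matrix, such that the centralizer $Z(A)$ is infinite. Then there is a matrix $U\in Z(A)$ which generates $Z(A)$ up to a finite group with $$\deg(U)\le \deg(A)\, q^{2\deg(A)}.$$
   Context: $\mathrm{GL}(2,\mathbb{F}[x])$ is the group of invertible two-by-two matrices over the polynomial ring $\mathbb{F}[x]$. For $A\in \mathrm{GL}(2,\mathbb{F}[x])$, the centralizer is $Z(A)=\{\,U\in \mathrm{GL}(2,\mathbb{F}[x]) \mid UAU^{-1}=A\,\}$. For a two-by-two matrix $A$ over $\mathbb{F}[x]$, $\deg(A)$ denotes the maximal degree of its entries. The paper recalls as well known that, for semisimple $A$ not equal to the identity matrix, $Z(A)$ is either finite or the direct product of an infinite cyclic group by a finite group; the matrix $U$ in the claim is a generator of the infinite part.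
   Formalization: ''Not equal to the identity matrix'' is replaced by ''not a scalar matrix'': for A = cI with c ≠ 1 in F*, the centralizer is all of GL(2,F[x]), which is infinite but not an infinite cyclic group times a finite group, so the claim as stated fails. *)

(* Defs.v *)
From HB Require Import structures.
From mathcomp Require Import all_boot all_order all_algebra.
From mathcomp Require Import boolp classical_sets functions cardinality.

Set Implicit Arguments.
Unset Strict Implicit.
Unset Printing Implicit Defensive.

Import GRing.Theory.
Local Open Scope classical_set_scope.
Local Open Scope ring_scope.

Section UnitGroup.
Variable R : unitRingType.
Implicit Types (u : R) (G H K : set R).

Definition unit_subgroup G : Prop :=
  [/\ forall g, G g -> g \is a GRing.unit,
      G 1,
      forall g h, G g -> G h -> G (g * h)
    & forall g, G g -> G g^-1].

Definition unit_centralizer u : set R :=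
  [set v | v \is a GRing.unit /\ v * u * v^-1 = u].

(* The exponent k ranges over int; this is a group only when u is a unit. *)
Definition cyclic_span u : set R := range (fun k : int => u ^ k).

Definition internal_direct_product G H K : Prop :=
  [/\ unit_subgroup H,
      unit_subgroup K,
      forall h k, H h -> K k -> h * k = k * h,
      H `&` K = [set 1]
    & G = [set h * k | h in H & k in K]].

Definition generates_up_to_finite u G : Prop :=
  infinite_set (cyclic_span u) /\
  exists2 T : set R, finite_set T & internal_direct_product G (cyclic_span u) T.

End UnitGroup.

(* Row spaces of square matrices represent the subspaces of 'rV[K]_n, on which
   A acts by right multiplication; semisimplicity is invariant under
   transposition, so the row convention is harmless. *)
Definition semisimple_mx (K : fieldType) (n : nat) (A : 'M[K]_n) : Prop :=
  forall V : 'M[K]_n, stablemx V A ->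
  exists W : 'M[K]_n,
    [/\ stablemx W A, (V :&: W)%MS = 0 & row_full (V + W)%MS].

(* Zero entries count as degree 0, which does not affect the maximum unless the
   whole matrix is zero. *)
Definition mxdeg (R : nzRingType) (m n : nat) (A : 'M[{poly R}]_(m, n)) : nat :=
  (\max_(i < m) \max_(j < n) (size (A i j)).-1)%N.

(* Main.v *)
Require Import Defs.
From HB Require Import structures.
From mathcomp Require Import all_boot all_order all_algebra closed_field.
From mathcomp Require Import boolp classical_sets functions cardinality.
From mathcomp Require Import ring zify.

Set Implicit Arguments.
Unset Strict Implicit.
Unset Printing Implicit Defensive.

Import GRing.Theory.
Local Open Scope classical_set_scope.
Local Open Scope ring_scope.

(** Write t and d for the trace and the determinant of A; d is a nonzero
    constant.  Over F(x), everything that commutes with A is a combination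
    a + b A, so the centralizer Z(A) is a group of units in an order of a
    quadratic algebra, and the question is about units of quadratic orders.

    The discriminant t^2 - 4d does not vanish ([disc_neq0]): otherwise A would
    have a double eigenvalue in F[x] and, being semisimple, would be scalar.
    In characteristic 2 this uses that F is perfect.  If t is constant, then
    det (a + b A) = a^2 + a b t + b^2 d is a form with constant coefficients
    that splits into two distinct linear factors over the algebraic closure of
    F; it takes a constant value only at constant a, b, and so Z(A) is finite
    ([centralizer_tr_const]).  Hence t is not constant.

    In that case the place at infinity splits in the quadratic algebra, and the
    eigenvalue of V in Z(A) at one of the two places has a degree, which is a
    homomorphism from Z(A) to the integers; its absolute value is the degree of
    the trace of V.  The completion at infinity is avoided by working with this
    absolute value alone.  What replaces the homomorphism property is that for
    commuting V and W, the polynomials tr (V W) and tr (V adj W) have the sum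
    tr V tr W ([mxtrace_mul_adjD]) and a product that is bounded in terms of the
    squares of the traces ([mxtrace_mul_adjM]).

    Bounds on the degrees of the sum and the product of two polynomials bound
    the degrees of both; this gives
    - that the elements of Z(A) with constant trace are closed under products;
    - that deg V <= deg A as soon as deg (tr V) <= deg t ([mxdeg_comm]): the
      coefficients of V as a combination of 1 and A are explicit expressions in
      these traces, with denominator t^2 - 4d.  In particular only finitely many
      V have constant trace.

    If on the contrary the sum has larger degree than half the degree of the
    product, then one of the two polynomials has small degree.  This is a step
    of the Euclidean algorithm: when deg (tr U) is positive and at most
    deg (tr V), one of V U and V U^-1 has a trace of smaller degree than V
    ([tr_descent]).  So an element U of Z(A) whose trace has the least positive
    degree generates Z(A) up to the finite group of elements with constant
    trace ([tr_generator]).  Since A itself competes in the choice of U, the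
    trace of U has degree at most deg t, whence deg U <= deg A, and the right
    hand side of the asserted bound is at least deg A. *)

(** * Two-by-two matrices over a commutative ring *)

Section TwoByTwo.
Variable R : comNzRingType.
Implicit Types V W A : 'M[R]_2.

Lemma ord2P (P : 'I_2 -> Prop) : P 0 -> P 1 -> forall i, P i.
Proof.
by move=> P0 P1 [[|[|//]] hi]; [move: P0|move: P1]; congr (P _); apply: val_inj.
Qed.

Lemma eq_mx22 V W :
  V 0 0 = W 0 0 -> V 0 1 = W 0 1 -> V 1 0 = W 1 0 -> V 1 1 = W 1 1 -> V = W.
Proof. by move=> *; apply/matrixP; apply: ord2P; apply: ord2P. Qed.

Lemma sum_ord2 (f : 'I_2 -> R) : \sum_i f i = f 0 + f 1.
Proof.
rewrite !big_ord_recl big_ord0 addr0.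
by congr (f _ + f _); apply: val_inj.
Qed.

Lemma lift_ord2 (i : 'I_2) (j : 'I_1) : lift i j = 1 - i.
Proof. by move: i; apply: ord2P; apply: val_inj; rewrite /= ?ord1. Qed.

Lemma mxtrace_mx22 V : \tr V = V 0 0 + V 1 1.
Proof. exact: sum_ord2. Qed.

Lemma mulr_mx22E V W i j : (V * W) i j = V i 0 * W 0 j + V i 1 * W 1 j.
Proof. by rewrite mxE sum_ord2. Qed.

Lemma det_mx22 V : \det V = V 0 0 * V 1 1 - V 0 1 * V 1 0.
Proof.
rewrite (expand_det_row _ 0) sum_ord2 /cofactor !det_mx11 !mxE !lift_ord2.
by rewrite subrr subr0 /= addn0 expr0 expr1; ring.
Qed.

Lemma adjugate_mx22 V : \adj V = (\tr V)%:M - V.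
Proof.
rewrite mxtrace_mx22; apply: eq_mx22.
all: rewrite !mxE /cofactor det_mx11 !mxE !lift_ord2 ?subrr ?subr0 /=.
- by rewrite addn0 expr0; ring.
- by rewrite expr1; ring.
- by rewrite expr1; ring.
- by rewrite -signr_odd expr0; ring.
Qed.

Lemma mulr_adj V : V * \adj V = (\det V)%:M.
Proof. exact: mul_mx_adj. Qed.

Lemma sqr_sub_scalar A mu :
  (A - mu%:M) * (A - mu%:M) = (mu ^+ 2)%:M - A * ((mu *+ 2)%:M - A).
Proof. by apply: eq_mx22; rewrite !(mulr_mx22E, mxE) /=; ring. Qed.

Lemma det_scalarDZ A a b :
  \det (a%:M + b *: A) = a ^+ 2 + a * b * \tr A + b ^+ 2 * \det A.
Proof. by rewrite mxtrace_mx22 !det_mx22 !mxE /=; ring. Qed.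

Lemma comm_scalarDZ A a b c d :
  (a%:M + b *: A) * (c%:M + d *: A) = (c%:M + d *: A) * (a%:M + b *: A).
Proof. by apply: eq_mx22; rewrite !(mulr_mx22E, mxE) /=; ring. Qed.

(** Since V + adj V = tr V and V adj V = det V, the adjugate is the conjugation
    of the quadratic algebra generated by V; up to a unit, adj W stands for the
    inverse of W in the next two lemmas. *)
Lemma mxtrace_mul_adjD V W : \tr (V * W) + \tr (V * \adj W) = \tr V * \tr W.
Proof.
rewrite -raddfD -mulrDr adjugate_mx22 subrKC mulrC.
by rewrite -mxtraceZ -mul_mx_scalar.
Qed.

(** In terms of the eigenvalues v, v' and w, w' this is
    (vw + v'w')(vw' + v'w) = ww'(v^2 + v'^2) + vv'(w^2 + w'^2).  For arbitrary
    V and W the left side minus the right side is det (V W - W V). *)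
Lemma mxtrace_mul_adjM V W : V * W = W * V ->
  \tr (V * W) * \tr (V * \adj W)
    = \det W * \tr V ^+ 2 + \det V * \tr W ^+ 2 - \det V * \det W *+ 4.
Proof.
move=> /eqP; rewrite -subr_eq0 => /eqP c0.
have d0 : \det (V * W - W * V) = 0 by rewrite c0 det0.
apply/eqP; rewrite -subr_eq0 -[X in _ == X]d0; apply/eqP.
by rewrite adjugate_mx22 !det_mx22 !mxtrace_mx22 !(mulr_mx22E, mxE) /=; ring.
Qed.

Lemma comm_mx22P V W : V * W = W * V ->
  [/\ V 0 1 * W 1 0 - W 0 1 * V 1 0 = 0,
      V 0 1 * (W 0 0 - W 1 1) - W 0 1 * (V 0 0 - V 1 1) = 0
    & V 1 0 * (W 0 0 - W 1 1) - W 1 0 * (V 0 0 - V 1 1) = 0].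
Proof.
move=> /eqP; rewrite -subr_eq0 => /eqP/matrixP c.
split; [move: (c 0 0)|move: (c 0 1)|move: (c 1 0)];
  rewrite !(mulr_mx22E, mxE) => e.
- by rewrite -[RHS]e; ring.
- by apply: oppr_inj; rewrite oppr0 -[RHS]e; ring.
- by rewrite -[RHS]e; ring.
Qed.

Definition disc A : R := \tr A ^+ 2 - \det A *+ 4.

(** Cramer's rule for the coefficients x, y of V = x + y A: they solve the
    linear system tr V = 2 x + t y, tr (V adj A) = t x + 2 d y, whose
    determinant is minus the discriminant of A. *)
Lemma disc_scale_comm V A : V * A = A * V ->
  disc A *: V =
  (\tr A * \tr (V * \adj A) - \det A * \tr V *+ 2)%:M
    + (\tr A * \tr V - \tr (V * \adj A) *+ 2) *: A.
Proof.
rewrite /disc => /comm_mx22P[e1 e2 e3].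
(* Each entry of the difference of the two sides is the combination of the
   three commutation relations that appears with zeros in their place. *)
apply: eq_mx22; apply/eqP; rewrite -subr_eq0; apply/eqP.
- transitivity (- (A 1 0 * 0) - A 0 1 * 0 : R); last by ring.
  rewrite -{1}e2 -e3 adjugate_mx22 !mxE !det_mx22 !mxtrace_mx22.
  by rewrite !(mulr_mx22E, mxE) /=; ring.
- transitivity ((A 0 0 - A 1 1) * 0 + A 0 1 *+ 2 * 0 : R); last by ring.
  rewrite -{1}e2 -e1 adjugate_mx22 !mxE !det_mx22 !mxtrace_mx22.
  by rewrite !(mulr_mx22E, mxE) /=; ring.
- transitivity ((A 0 0 - A 1 1) * 0 - A 1 0 *+ 2 * 0 : R); last by ring.
  rewrite -{1}e3 -e1 adjugate_mx22 !mxE !det_mx22 !mxtrace_mx22.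
  by rewrite !(mulr_mx22E, mxE) /=; ring.
- transitivity (A 1 0 * 0 + A 0 1 * 0 : R); last by ring.
  rewrite -{1}e2 -e3 adjugate_mx22 !mxE !det_mx22 !mxtrace_mx22.
  by rewrite !(mulr_mx22E, mxE) /=; ring.
Qed.

End TwoByTwo.

(** * Degrees of polynomials and of polynomial matrices *)

Section Degrees.
Variable R : idomainType.
Implicit Types (p q : {poly R}) (V W A : 'M[{poly R}]_2).

Lemma size_mul_le p q (m n : nat) :
  (size p <= m.+1)%N -> (size q <= n.+1)%N -> (size (p * q)%R <= (m + n).+1)%N.
Proof. by move=> sp sq; apply: leq_trans (size_polyMleq _ _) _; lia. Qed.

Lemma size_add_le p q (n : nat) :
  (size p <= n)%N -> (size q <= n)%N -> (size (p + q)%R <= n)%N.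
Proof.
by move=> sp sq; apply: leq_trans (size_polyD _ _) _; rewrite geq_max sp.
Qed.

Lemma size_muln_le p (k n : nat) : (size p <= n)%N -> (size (p *+ k)%R <= n)%N.
Proof. by move=> sp; rewrite -scaler_nat (leq_trans (size_scale_leq _ _)). Qed.

Lemma size_mul_eq1 p q : size (p * q) = 1%N -> size p = 1%N /\ size q = 1%N.
Proof.
have [->|p0] := eqVneq p 0; first by rewrite mul0r size_poly0.
have [->|q0] := eqVneq q 0; first by rewrite mulr0 size_poly0.
move: p0 q0; rewrite -!size_poly_gt0 => p0 q0.
by rewrite size_mul -?size_poly_gt0 //; lia.
Qed.

(** If p had degree more than k, cancellation in the sum would force q to have
    the same degree, and the product would be too large. *)
Lemma size_sum_prod p q (k : nat) :
  (size (p + q)%R <= k.+1)%N -> (size (p * q)%R <= k.*2.+1)%N ->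
  (size p <= k.+1)%N.
Proof.
move=> sD sM; rewrite leqNgt; apply/negP => sp.
have p0 : p != 0 by rewrite -size_poly_gt0; lia.
have sq : size q = size p.
  case: (ltngtP (size q) (size p)) => // lt_size.
    by have e := size_polyDl lt_size; move: sD; rewrite e; lia.
  by have e := size_polyDl lt_size; move: e sD; rewrite addrC => ->; lia.
have q0 : q != 0 by rewrite -size_poly_gt0; lia.
by move: sM; rewrite size_mul // sq; lia.
Qed.

(** One of p, q has degree at least a + m; if the other had degree at least a,
    the product would have degree at least 2a + m. *)
Lemma size_sum_prod_gap p q (a m : nat) : (0 < m)%N ->
    ((a + m).+1 <= size (p + q)%R)%N -> (size (p * q)%R <= a.*2.+1)%N ->
  (size p <= a)%N \/ (size q <= a)%N.
Proof.
move=> m0 sD sM; apply/orP; apply: contraTT sM.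
rewrite negb_or -!ltnNge => /andP[sp sq].
have p0 : p != 0 by rewrite -size_poly_gt0; lia.
have q0 : q != 0 by rewrite -size_poly_gt0; lia.
have := leq_trans sD (size_polyD p q).
by rewrite size_mul //; lia.
Qed.

Lemma size_tr_mul V W (k : nat) : V * W = W * V ->
    (size (\det V) <= 1)%N -> (size (\det W) <= 1)%N ->
    (size (\tr V) <= k.+1)%N -> (size (\tr W) <= k.+1)%N ->
  (size (\tr (V * W)%R) <= k.*2.+1)%N /\
  (size (\tr (V * \adj W)%R) <= k.*2.+1)%N.
Proof.
move=> c dV dW tV tW.
have sD : (size (\tr (V * W)%R + \tr (V * \adj W)%R)%R <= k.*2.+1)%N.
  by rewrite mxtrace_mul_adjD -addnn size_mul_le.
have sM : (size (\tr (V * W)%R * \tr (V * \adj W)%R)%R <= k.*2.+1)%N.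
  rewrite mxtrace_mul_adjM // !expr2 -addnn; apply: size_add_le.
    by apply: size_add_le; apply: (@size_mul_le _ _ 0) => //; apply: size_mul_le.
  rewrite size_polyN; apply: size_muln_le.
  by apply: leq_trans (@size_mul_le _ _ 0 0 dV dW) _; lia.
have le : (k.*2.+1 <= k.*2.*2.+1)%N by lia.
split; first exact: size_sum_prod sD (leq_trans sM le).
move: sD sM; rewrite addrC mulrC => sD sM.
exact: size_sum_prod sD (leq_trans sM le).
Qed.

Lemma mxdegP m n (V : 'M[{poly R}]_(m, n)) d :
  reflect (forall i j, (size (V i j) <= d.+1)%N) (mxdeg V <= d)%N.
Proof.
apply: (iffP idP) => [/bigmax_leqP h i j|h].
  by have /bigmax_leqP/(_ j isT) := h i isT; case: size.
apply/bigmax_leqP => i _; apply/bigmax_leqP => j _.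
by move: (h i j); case: size.
Qed.

Lemma size_tr_mxdeg V : (size (\tr V) <= (mxdeg V).+1)%N.
Proof.
by rewrite mxtrace_mx22; apply: size_add_le; have /mxdegP := leqnn (mxdeg V).
Qed.

(** With n the degree of the trace of A, the discriminant of A has degree 2n,
    while in [disc_scale_comm] the numerators of the coefficients of 1 and A
    have degrees at most 3n and 2n. *)
Lemma mxdeg_comm V A : V * A = A * V ->
    (size (\det V) <= 1)%N -> (size (\det A) <= 1)%N ->
    (1 < size (\tr A))%N -> (size (\tr V) <= size (\tr A))%N ->
  (mxdeg V <= mxdeg A)%N.
Proof.
move=> c dV dA tA tVA; set d := mxdeg A.
have [n sA] : exists n, size (\tr A) = n.+1 by exists (size (\tr A)).-1; lia.
have n_le : (n <= d)%N by rewrite -ltnS -sA size_tr_mxdeg.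
rewrite sA in tVA tA.
have [_ s2] := size_tr_mul c dV dA tVA (eq_leq sA).
have tA0 : \tr A != 0 by rewrite -size_poly_gt0 sA.
have sD : size (disc A) = n.*2.+1.
  have st : size (\tr A ^+ 2) = n.*2.+1 by rewrite expr2 size_mul // sA; lia.
  rewrite /disc size_polyDl // st size_polyN.
  by apply: leq_ltn_trans (size_muln_le _ dA) _; lia.
have D0 : disc A != 0 by rewrite -size_poly_gt0 sD.
apply/mxdegP => i j.
have [->|V0] := eqVneq (V i j) 0; first by rewrite size_poly0.
have := congr1 (fun M : 'M[{poly R}]_2 => size (M i j)) (disc_scale_comm c).
rewrite mxE size_mul // sD => e.
suff : ((n.*2.+1 + size (V i j)).-1 <= (n.*2 + d).+1)%N by lia.
rewrite e !mxE; apply: size_add_le.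
  apply: size_muln_le; apply: size_add_le.
    by apply: leq_trans (size_mul_le (eq_leq sA) s2) _; lia.
  rewrite size_polyN; apply: size_muln_le.
  by apply: leq_trans (size_mul_le (n := n) dA tVA) _; lia.
apply: size_mul_le; last by move/mxdegP: (leqnn d); apply.
apply: size_add_le.
  by rewrite -addnn; apply: size_mul_le => //; rewrite sA.
by rewrite size_polyN; apply: size_muln_le.
Qed.

End Degrees.

Lemma finite_mxdeg (F : finFieldType) m n d :
  finite_set [set V : 'M[{poly F}]_(m, n) | (mxdeg V <= d)%N].
Proof.
apply: (@sub_finite_set _ _
  ((fun W : 'M['rV[F]_d.+1]_(m, n) => map_mx rVpoly W) @` setT)).
  move=> V /mxdegP sV; exists (map_mx (@poly_rV _ d.+1) V) => //.
  by apply/matrixP => i j; rewrite !mxE poly_rV_K.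
exact/finite_image/finite_finset.
Qed.

(** * Semisimplicity and the discriminant *)

(** A stable complement W of ker (A - mu) is mapped by A - mu into itself and,
    as (A - mu)^2 = 0, into the kernel; so A - mu kills W as well. *)
Lemma semisimple_sqr0 (K : fieldType) n (A : 'M[K]_n) mu :
  semisimple_mx A -> (A - mu%:M) *m (A - mu%:M) = 0 -> A = mu%:M.
Proof.
move=> ss sq0; set N := A - mu%:M in sq0 *.
have AE : A = N + mu%:M by rewrite subrK.
have [|W [stW VW full]] := ss (kermx N).
  by rewrite [in X in (X <= _)%MS]AE mulmxDr mulmx_ker add0r stablemxC.
have WN_W : (W *m N <= W)%MS.
  by rewrite mulmxBr addmx_sub // eqmx_opp stablemxC.
have /sub_kermxP WN0 : (W <= kermx N)%MS.
  apply/sub_kermxP/eqP; rewrite -submx0 -VW sub_capmx WN_W andbT.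
  by apply/sub_kermxP; rewrite -mulmxA sq0 mulmx0.
have /(submx_trans (submx_full _ full)) : (kermx N + W <= kermx N)%MS.
  by rewrite addsmx_sub submx_refl; apply/sub_kermxP.
by move=> /(_ _ 1%:M)/sub_kermxP; rewrite mul1mx => N0; rewrite AE N0 add0r.
Qed.

(** In characteristic 2 squaring is additive, hence injective, and on a finite
    field bijective. *)
Lemma exists_sqrt_pchar2 (F : finFieldType) (x : F) :
  2%:R = 0 :> F -> exists y, x = y ^+ 2.
Proof.
move=> F2; have inj : injective (fun y : F => y ^+ 2).
  move=> y z /eqP; rewrite -subr_eq0 => /eqP e.
  apply/eqP; rewrite -subr_eq0 -sqrf_eq0; apply/eqP; rewrite -e.
  transitivity (y ^+ 2 - z ^+ 2 + 2%:R * (z ^+ 2 - y * z)); first by ring.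
  by rewrite F2 mul0r addr0.
by exists (invF inj x); rewrite (f_invF inj).
Qed.

(** A quadratic polynomial X^2 - t X + d with discriminant 0 and constant d is
    a square: mu is t / 2 in odd characteristic, and a square root of d in
    characteristic 2. *)
Lemma disc0_eigenvalue (F : finFieldType) (t d : {poly F}) :
    (size d <= 1)%N -> t ^+ 2 - d *+ 4 = 0 ->
  exists mu, t = mu *+ 2 /\ d = mu ^+ 2.
Proof.
move=> /size1_polyC dE D0; have [F2|F2] := eqVneq (2%:R : F) 0.
  have P2 : 2%:R = 0 :> {poly F} by rewrite -polyC_natr F2 polyC0.
  have P4 p : p *+ 4 = 0 :> {poly F}.
    by rewrite -mulr_natr (natrM _ 2 2) P2 mul0r mulr0.
  have [y dy] := exists_sqrt_pchar2 d`_0 F2.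
  exists y%:P; split; last by rewrite dE dy polyC_exp.
  rewrite -mulr_natr P2 mulr0; apply/eqP; rewrite -sqrf_eq0.
  by move: D0; rewrite P4 subr0 => ->.
have P2 : 2^-1%:P * 2%:R = 1 :> {poly F}.
  by rewrite -polyC_natr -polyCM mulVf.
exists (2^-1%:P * t); split; first by rewrite -[LHS]mul1r -P2; ring.
rewrite exprMn; have -> : t ^+ 2 = 2%:R * 2%:R * d.
  by rewrite -natrM mulr_natl; apply/eqP; rewrite -subr_eq0 D0.
transitivity (((2^-1)%:P * 2%:R) ^+ 2 * d); first by rewrite P2 expr1n mul1r.
by ring.
Qed.

Lemma disc_neq0 (F : finFieldType) (A : 'M[{poly F}]_2) :
    (size (\det A) <= 1)%N -> ~~ is_scalar_mx A ->
    semisimple_mx (map_mx (@tofrac {poly F}) A) ->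
  disc A != 0.
Proof.
move=> dA nsc ss; apply/negP => /eqP /(disc0_eigenvalue dA)[mu [tE dE]].
have sq0 : (A - mu%:M) * (A - mu%:M) = 0.
  by rewrite sqr_sub_scalar -tE -adjugate_mx22 mulr_adj dE subrr.
move: nsc; apply/negP/negPn/is_scalar_mxP; exists mu.
have /(semisimple_sqr0 ss) :
    (map_mx (@tofrac {poly F}) A - (tofrac mu)%:M)
      *m (map_mx (@tofrac {poly F}) A - (tofrac mu)%:M) = 0.
  by rewrite -map_scalar_mx -map_mxB -map_mxM [X in map_mx _ X]sq0 map_mx0.
rewrite -map_scalar_mx => /matrixP e; apply/matrixP => i j.
by apply/eqP; rewrite -tofrac_eq; apply/eqP; have := e i j; rewrite !mxE.
Qed.

(** * Centralizers of matrices with constant trace *)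

Lemma root_pdeg2 (K : closedFieldType) (t d : K) :
  exists r, r ^+ 2 = t * r - d.
Proof.
have [r e] :=
  @GRing.solve_monicpoly K 2 (fun i => if i == 0%N then - d else t) isT.
by exists r; rewrite e !big_ord_recl big_ord0 /= expr0 expr1 mulr1 addr0 addrC.
Qed.

(** Over an algebraic closure the form is (a + r b)(a + r' b) with constants
    r <> r'.  Both factors divide a nonzero constant, so they are constants,
    and a and b are constant combinations of them. *)
Lemma norm_form_const (F : countFieldType) (t d : F) (a b : {poly F}) :
    t ^+ 2 - d *+ 4 != 0 ->
    size (a ^+ 2 + a * b * t%:P + b ^+ 2 * d%:P) = 1%N ->
  (size a <= 1)%N /\ (size b <= 1)%N.
Proof.
move=> D0 sN; have [K [f _]] := countable_algebraic_closure F.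
have [r re] := root_pdeg2 (f t) (f d).
set a' := map_poly f a; set b' := map_poly f b.
have [s1 s2] : size (a' + r *: b') = 1%N /\ size (a' + (f t - r) *: b') = 1%N.
  apply: size_mul_eq1; rewrite -[RHS]sN -(size_map_poly f).
  rewrite !(rmorphD, rmorphM, rmorphXn) /= !map_polyC -/a' -/b'.
  congr (size (_ : {poly K})); rewrite -!mul_polyC rmorphB /=.
  have -> : (f d)%:P = (f t)%:P * r%:P - r%:P ^+ 2 :> {poly K}.
    by rewrite -polyC_exp -polyCM -polyCB re; congr _%:P; ring.
  by ring.
have r12 : r - (f t - r) != 0.
  rewrite -sqrf_eq0; apply: contraNneq D0 => e.
  rewrite -(fmorph_eq0 f) rmorphB rmorphXn rmorphMn -e; apply/eqP.
  have -> : f d = f t * r - r ^+ 2 by rewrite re; ring.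
  by ring.
have sb : (size b' <= 1)%N.
  rewrite -(size_scale _ r12) scalerBl.
  have -> : r *: b' - (f t - r) *: b'
              = (a' + r *: b') - (a' + (f t - r) *: b') :> {poly K}.
    by rewrite opprD addrACA subrr add0r.
  by apply: size_add_le; rewrite ?size_polyN ?s1 ?s2.
split; last by rewrite -(size_map_poly f).
rewrite -(size_map_poly f) -/a' -[a'](addrK (r *: b')).
apply: size_add_le; first by rewrite s1.
by rewrite size_polyN (leq_trans (size_scale_leq _ _)).
Qed.

Lemma unit_centralizerP (R : unitRingType) (u v : R) :
  unit_centralizer u v <-> v \is a GRing.unit /\ GRing.comm v u.
Proof.
split=> -[vu e]; split=> //; first by rewrite /GRing.comm -[in RHS]e divrK.
by rewrite e mulrK.
Qed.

Lemma size_det_unit (F : fieldType) (V : 'M[{poly F}]_2) :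
  V \is a GRing.unit -> size (\det V) = 1%N.
Proof. by rewrite [_ \in _]unitmxE poly_unitE => /andP[/eqP]. Qed.

Lemma det_unit_le1 (F : fieldType) (V : 'M[{poly F}]_2) :
  V \is a GRing.unit -> (size (\det V) <= 1)%N.
Proof. by move/size_det_unit->. Qed.

Lemma centralizer_tr_const (F : finFieldType) (A : 'M[{poly F}]_2) :
    A \is a GRing.unit -> (size (\tr A) <= 1)%N -> disc A != 0 ->
  finite_set (unit_centralizer A).
Proof.
move=> Au sT; have /eqP/size_poly1P [d _ dE] := size_det_unit Au.
have [t tE] : exists t, \tr A = t%:P by exists (\tr A)`_0; exact: size1_polyC.
move=> D0; apply: (sub_finite_set _ (@finite_mxdeg F 2 2 (mxdeg A))).
move=> V /unit_centralizerP[Vu c]; have := disc_scale_comm c.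
set x := (X in X%:M); set y := (X in X *: A); move: D0.
rewrite /disc tE dE.
have -> : t%:P ^+ 2 - d%:P *+ 4 = (t ^+ 2 - d *+ 4)%:P.
  by rewrite polyCB polyC_exp polyCMn.
set D := t ^+ 2 - d *+ 4; rewrite polyC_eq0 => D0 e.
have VE : V = (D^-1%:P * x)%:M + (D^-1%:P * y) *: A.
  transitivity (D^-1%:P *: (D%:P *: V)).
    by rewrite scalerA -polyCM mulVf // scale1r.
  by rewrite e scalerDr scalerA scale_scalar_mx.
move: VE (size_det_unit Vu); set a := _ * x; set b := _ * y => ->.
rewrite det_scalarDZ tE dE => /(norm_form_const D0)[sa sb].
apply/mxdegP => i j; rewrite !mxE; apply: size_add_le.
  by apply: size_muln_le; apply: leq_trans sa _.
by apply: (@size_mul_le _ _ _ 0) => //; apply/mxdegP: i j.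
Qed.

(** * Groups of units *)

Section UnitGroups.
Variable R : unitRingType.
Implicit Types (u v w : R) (G : set R).

Lemma unit_subgroup_centralizer u : unit_subgroup (unit_centralizer u).
Proof.
split=> [v []//||v w|v]; rewrite ?unit_centralizerP.
- by split; [exact: unitr1 | exact/commr_sym/commr1].
- move=> [uv cv] [uw cw]; split; first by rewrite unitrMl.
  exact/commr_sym/commrM/commr_sym.
by move=> [uv cv]; split; [rewrite unitrV | exact/commr_sym/commrV/commr_sym].
Qed.

Lemma unit_subgroupX G v (k : int) : unit_subgroup G -> G v -> G (v ^ k).
Proof.
move=> [_ G1 GM GV] Gv; have GX n : G (v ^+ n).
  by elim: n => [|n IH]; rewrite ?expr0 // exprS; apply: GM.
by case: k => n; [exact: GX | exact/GV/GX].
Qed.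

Lemma unit_subgroup_span u :
  u \is a GRing.unit -> unit_subgroup (cyclic_span u).
Proof.
move=> Uu; split.
- by move=> _ [k _ <-]; rewrite unitrXz.
- by exists 0.
- by move=> _ _ [k _ <-] [l _ <-]; exists (k + l) => //; rewrite exprzDr.
by move=> _ [k _ <-]; exists (- k) => //; rewrite -invr_expz.
Qed.

End UnitGroups.

(** * Traces of powers and inverses *)

Section TracesOfUnits.
Variable F : fieldType.
Implicit Types V W : 'M[{poly F}]_2.

Lemma size_tr_divr V W : W \is a GRing.unit ->
  size (\tr (V * \adj W)) = size (\tr (V * W^-1)).
Proof.
move=> Wu; have /eqP/size_poly1P [d d0 dE] := size_det_unit Wu.
have -> : \adj W = (d%:P) *: W^-1.
  by apply: (mulrI Wu); rewrite mulr_adj dE -scalerAr divrr // scalemx1.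
by rewrite -scalerAr mxtraceZ mul_polyC size_scale.
Qed.

Lemma size_trV V : V \is a GRing.unit -> size (\tr V^-1) = size (\tr V).
Proof.
move=> Vu; rewrite -[V^-1]mul1r -size_tr_divr // mul1r adjugate_mx22.
by rewrite raddfB /= mxtrace_scalar mulr2n addrK.
Qed.

(** Induction along the recurrence
    tr (V^(n+2)) = tr (V^(n+1)) tr V - det V tr (V^n), in which the first term
    dominates.  The case of V^0, whose trace 2 may vanish, only has a bound. *)
Lemma size_trX V m n : V \is a GRing.unit -> (0 < m)%N ->
  size (\tr V) = m.+1 -> size (\tr (V ^+ n.+1)) = (n.+1 * m).+1.
Proof.
move=> Vu m0 tV.
suff : size (\tr (V ^+ n.+1)) = (n.+1 * m).+1 /\
       (size (\tr (V ^+ n)) <= (n * m).+1)%N by case.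
elim: n => [|n [IH1 IH2]].
  split; first by rewrite expr1 mul1n.
  by rewrite expr0 mxtrace1 -polyC_natr size_polyC_leq1.
split; last by rewrite IH1.
have := mxtrace_mul_adjD (V ^+ n.+1) V.
rewrite [in X in _ + \tr X]exprSr -mulrA mulr_adj [V ^+ n * _]mul_mx_scalar.
rewrite mxtraceZ -exprSr => /(canRL (addrK _)) ->.
have sM : size (\tr (V ^+ n.+1) * \tr V) = (n.+2 * m).+1.
  by rewrite size_mul -?size_poly_gt0 ?IH1 ?tV //; lia.
rewrite size_polyDl // sM size_polyN.
by apply: leq_ltn_trans (size_mul_le (m := 0) (det_unit_le1 Vu) IH2) _; lia.
Qed.

Lemma size_trXz V (k : int) : V \is a GRing.unit -> (1 < size (\tr V))%N ->
  k != 0 -> (1 < size (\tr (V ^ k)))%N.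
Proof.
move=> Vu tV k0; have sV : size (\tr V) = (size (\tr V)).-1.+1 by lia.
have m0 : (0 < (size (\tr V)).-1)%N by lia.
case: k k0 => [[|n]|n] // _; first by rewrite (size_trX n Vu m0 sV); lia.
by rewrite NegzE -invr_expz size_trV ?unitrX // (size_trX n Vu m0 sV); lia.
Qed.

Lemma infinite_span V : V \is a GRing.unit -> (1 < size (\tr V))%N ->
  infinite_set (cyclic_span V).
Proof.
move=> Vu tV; apply/infiniteP.
have inj : injective (fun k : nat => V ^ k).
  move=> i j e; apply/eqP; have : i%:Z - j%:Z == 0.
    apply: contraT => /(size_trXz Vu tV).
    rewrite exprzDr // -invr_expz e divrr ?unitrXz // mxtrace1 -polyC_natr.
    by rewrite ltnNge size_polyC_leq1.
  by rewrite subr_eq0.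
have : ((fun k : nat => V ^ k) @^-1` cyclic_span V #<= cyclic_span V)%card.
  by apply: card_ge_preimage => i j _ _ /inj.
by congr (_ #<= _)%card; apply/seteqP; split => // i _; exists (Posz i).
Qed.

End TracesOfUnits.

(** * The centralizer of a matrix with nonconstant trace *)

Section Centralizer.
Variables (F : finFieldType) (A : 'M[{poly F}]_2).
Hypothesis A_unit : A \is a GRing.unit.
Hypothesis A_disc : disc A != 0.
Hypothesis A_tr : (1 < size (\tr A))%N.
Local Notation Z := (unit_centralizer A).
Implicit Types V W : 'M[{poly F}]_2.

Lemma comm_mx22_trans V W : V * A = A * V -> W * A = A * W -> V * W = W * V.
Proof.
move=> /disc_scale_comm eV /disc_scale_comm eW.
apply/matrixP => i j; apply: (mulfI A_disc); apply: (mulfI A_disc).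
have : (disc A *: V) * (disc A *: W) = (disc A *: W) * (disc A *: V).
  by rewrite eV eW comm_scalarDZ.
rewrite -!scalerAl -!scalerAr => /matrixP/(_ i j).
by rewrite mxE [X in disc A * X]mxE [X in _ = X]mxE [X in _ = disc A * X]mxE.
Qed.

(** The torsion subgroup of Z: the elements whose eigenvalues are
    algebraic over F. *)
Definition tr_const : set 'M[{poly F}]_2 :=
  [set V | Z V /\ (size (\tr V) <= 1)%N].

Lemma unit_subgroup_tr_const : unit_subgroup tr_const.
Proof.
have [ZU Z1 ZM ZV] := unit_subgroup_centralizer A; split.
- by move=> V [/ZU].
- by split=> //; rewrite mxtrace1 -polyC_natr size_polyC_leq1.
- move=> V W [ZV' tV] [ZW tW]; split; first exact: ZM.
  have /unit_centralizerP[Vu Vc] := ZV'.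
  have /unit_centralizerP[Wu Wc] := ZW.
  by have [] := size_tr_mul (k := 0) (comm_mx22_trans Vc Wc)
                  (det_unit_le1 Vu) (det_unit_le1 Wu) tV tW.
by move=> V [ZV' tV]; split; [exact: ZV | rewrite size_trV //; exact: ZU].
Qed.

Lemma finite_tr_const : finite_set tr_const.
Proof.
apply: (sub_finite_set _ (@finite_mxdeg F 2 2 (mxdeg A))).
move=> V [/unit_centralizerP[Vu Vc] tV].
by apply: mxdeg_comm => //; rewrite ?det_unit_le1 // (leq_trans tV) // ltnW.
Qed.

(** With a = deg (tr V) at least m = deg (tr U) > 0, the traces of V U and of
    V adj U have a sum of degree a + m and a product of degree at most 2a. *)
Lemma tr_descent U V : Z U -> (1 < size (\tr U) <= size (\tr V))%N -> Z V ->
  (size (\tr (V * U)) < size (\tr V))%N \/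
  (size (\tr (V * U^-1)) < size (\tr V))%N.
Proof.
move=> /unit_centralizerP[Uu Uc] /andP[tU tUV] /unit_centralizerP[Vu Vc].
rewrite -size_tr_divr //; set n := size (\tr V) in tUV *.
have c := comm_mx22_trans Vc Uc.
have [m [m0 sU]] : exists m, (0 < m)%N /\ size (\tr U) = m.+1.
  by exists (size (\tr U)).-1; lia.
have [a sV] : exists a, n = a.+1 by exists n.-1; lia.
rewrite sV !ltnS; apply: (size_sum_prod_gap m0).
  have V0 : \tr V != 0 by rewrite -size_poly_gt0 -/n sV.
  have U0 : \tr U != 0 by rewrite -size_poly_gt0 sU.
  by rewrite mxtrace_mul_adjD size_mul // -/n sV sU; lia.
have sVV : (size (\tr V * \tr V)%R <= a.*2.+1)%N.
  by rewrite -addnn; apply: size_mul_le; rewrite -/n sV.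
have sUU : (size (\tr U * \tr U)%R <= a.*2.+1)%N.
  by rewrite -addnn; apply: size_mul_le; rewrite -sV.
rewrite mxtrace_mul_adjM // !expr2; apply: size_add_le.
  by apply: size_add_le; apply: (@size_mul_le _ _ _ 0); rewrite ?det_unit_le1.
rewrite size_polyN; apply: size_muln_le.
by apply: leq_trans (@size_mul_le _ _ _ 0 0 _ _) _; rewrite ?det_unit_le1.
Qed.

(** The trace of a nonzero power of U is not constant, so the powers of U are
    distinct and meet [tr_const] only in 1.  By [tr_descent], multiplying V by
    U or its inverse lowers the degree of the trace as long as it is positive:
    by minimality, it is then at least that of the trace of U. *)
Lemma tr_generator U : Z U -> (1 < size (\tr U))%N ->
    (forall V, Z V -> (1 < size (\tr V))%N ->
       (size (\tr U) <= size (\tr V))%N) ->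
  generates_up_to_finite U Z.
Proof.
move=> ZU tU minU; have /unit_centralizerP[Uu Uc] := ZU.
have Zgrp := unit_subgroup_centralizer A; have [_ Z1 ZM ZV] := Zgrp.
split; first exact: infinite_span.
exists tr_const; first exact: finite_tr_const.
have ZUk k : Z (U ^ k) by exact: unit_subgroupX.
split.
- exact: unit_subgroup_span.
- exact: unit_subgroup_tr_const.
- move=> _ V [k _ <-] [/unit_centralizerP[_ Vc] _].
  by have /unit_centralizerP[_ /comm_mx22_trans] := ZUk k; apply.
- apply/seteqP; split=> [_ [[k _ <-] [_]]|_ ->].
    rewrite leqNgt; have [-> _|k0] := eqVneq k 0; first by rewrite /= expr0z.
    by rewrite size_trXz.
  by have [_ T1 _ _] := unit_subgroup_tr_const; split=> //; exists 0.
apply/seteqP; split=> [V ZVV|_ [_ [k _ <-] [W [ZW _] <-]]]; last exact: ZM.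
have [n] := ubnP (size (\tr V)); elim: n V ZVV => // n IH V ZVV lt_n.
have [tV|tV] := leqP (size (\tr V)) 1.
  by exists 1; [exists 0 | exists V; rewrite ?mul1r].
have ZI := ZV _ ZU; have tUV := minU _ ZVV tV.
have /unit_centralizerP[_ Vc] := ZVV.
have le_U : (1 < size (\tr U) <= size (\tr V))%N by rewrite tU.
have [lt|lt] := tr_descent ZU le_U ZVV.
  have [_ [k _ <-] [W TW e]] := IH _ (ZM _ _ ZVV ZU) (leq_trans lt lt_n).
  exists (U ^ (k - 1)); first by exists (k - 1).
  exists W => //; rewrite addrC exprzDr // -mulrA e exprN1.
  by rewrite (comm_mx22_trans Vc Uc) mulKr.
have [_ [k _ <-] [W TW e]] := IH _ (ZM _ _ ZVV ZI) (leq_trans lt lt_n).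
exists (U ^ (k + 1)); first by exists (k + 1).
exists W => //; rewrite addrC exprzDr // -mulrA e expr1z mulrA.
by rewrite (comm_mx22_trans Uc Vc) mulrK.
Qed.

End Centralizer.

Theorem theorem1p3 (F : finFieldType) (A : 'M[{poly F}]_2)
    (A_unit : A \is a GRing.unit)
    (A_semisimple : semisimple_mx (map_mx (@tofrac {poly F}) A))
    (A_nonscalar : ~~ is_scalar_mx A)
    (ZA_infinite : infinite_set (unit_centralizer A)) :
  exists U : 'M[{poly F}]_2,
    [/\ unit_centralizer A U,
        generates_up_to_finite U (unit_centralizer A)
      & (mxdeg U <= mxdeg A * #|F| ^ (2 * mxdeg A))%N].
Proof.
have D0 : disc A != 0 by apply: disc_neq0 => //; exact: det_unit_le1.
have tA : (1 < size (\tr A))%N.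
  by rewrite ltnNge; apply/negP => /(centralizer_tr_const A_unit)/(_ D0).
have ZA : unit_centralizer A A by apply/unit_centralizerP.
pose P n := `[< exists U,
  [/\ unit_centralizer A U, (1 < size (\tr U))%N & size (\tr U) = n] >].
have exP : exists n, P n by exists (size (\tr A)); apply/asboolP; exists A.
case: (ex_minnP exP) => n /asboolP[U [ZU tU nE]] minU; subst n.
exists U; split=> //.
  by apply: tr_generator => // V ZV tV; apply/minU/asboolP; exists V.
have /unit_centralizerP[Uu Uc] := ZU.
apply: (@leq_trans (mxdeg A)).
  by apply: mxdeg_comm; rewrite ?det_unit_le1 //; apply/minU/asboolP; exists A.
by rewrite leq_pmulr // expn_gt0; apply/orP; left; apply/card_gt0P; exists 0.
Qed.
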